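(* Let $m$ be an odd positive integer and let $W=(w_{-r},\ldots,w_r)\in\mathbb{Z}^{2r+1}$ be the weight sequence of a one-dimensional additive cellular automaton such that $\sigma=2\sigma'$ and $\sigma$ is invertible modulo $m$. Let $a,d\in\mathbb{Z}/m\mathbb{Z}$ with $d$ invertible. Then, in the orbit $\mathcal{O}(\mathrm{AP}(a,d))$, every $(0,1)$-antisymmetric triangle of orientation $(1,1)$ or $(-1,-1)$ and of size $s$ is balanced, for all positive integers $s\equiv 0$ or $-1\pmod{\mathrm{lcm}(\mathrm{pord}_m(\sigma),m)}$.
   Context: The ACA with weights $W$ maps a sequence $(a_i)_{i\in\mathbb{Z}}$ of $\mathbb{Z}/m\mathbb{Z}$ to $\left(\sum_{j=-r}^{r}w_ja_{i+j}\right)_{i\in\mathbb{Z}}$; $\sigma=\sum_jw_j$, $\sigma'=\sum_j jw_j$. $\mathrm{AP}(a,d)=(a+id)_{i\in\mathbb{Z}}$. The orbit is the array $(a_{i,j})_{(i,j)\in\mathbb{Z}\times\mathbb{N}}$ whose $j$-th row is $\partial^j(\mathrm{AP}(a,d))$. The triangle with principal vertex $j\in\mathbb{Z}\times\mathbb{N}$, orientation $\varepsilon\in\{-1,1\}^2$ and size $s$ is the multiset $\{a_{j+\varepsilon\cdot k}: k\in\mathbb{N}^2,\ k_1+k_2\le s-1\}$ ($\varepsilon\cdot k=(\varepsilon_1k_1,\varepsilon_2k_2)$, indices in $\mathbb{Z}\times\mathbb{N}$). It is $(0,1)$-antisymmetric if $a_{j+\varepsilon\cdot k}+a_{j+\varepsilon\cdot(s-1-k_1-k_2,\,k_2)}=0$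 for all $k\in\mathbb{N}^2$ with $k_1+k_2\le s-1$. Balanced means every element of $\mathbb{Z}/m\mathbb{Z}$ occurs with the same multiplicity. $\mathrm{pord}_m(\sigma)$ is the multiplicative order of $\sigma$ in $(\mathbb{Z}/m\mathbb{Z})^*/\{-1,1\}$, i.e. the least $k\ge1$ with $\sigma^k\equiv\pm1\pmod m$. *)

(* Defs.v *)
From HB Require Import structures.
From mathcomp Require Import all_boot all_order all_algebra cyclic.

Set Implicit Arguments.
Unset Strict Implicit.
Unset Printing Implicit Defensive.

Import GRing.Theory Num.Theory.
Local Open Scope ring_scope.

(* Z/mZ for m > 0, including the trivial ring m = 1 (where 'Z_m would be Z/2Z).
   It is a zmodType; integers act by *~, and the product is Zp_mul. *)
Notation Zmod m := 'I_m.-1.+1.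

Definition invertible (m : nat) (d : Zmod m) : Prop :=
  exists e : Zmod m, Zp_mul d e = Zp1.

Definition invertible_mod (m : nat) (x : int) : Prop :=
  exists y : int, (x * y = 1 %[mod m])%Z.

(* W = (w_{-r}, ..., w_r): entry number j of the tuple is w_{j-r}. *)
Definition widx (r : nat) (j : 'I_r.*2.+1) : int := (j : nat)%:Z - r%:Z.

Definition sigma (r : nat) (W : r.*2.+1.-tuple int) : int :=
  \sum_(j < r.*2.+1) tnth W j.

Definition sigma' (r : nat) (W : r.*2.+1.-tuple int) : int :=
  \sum_(j < r.*2.+1) widx j * tnth W j.

Definition aca (m r : nat) (W : r.*2.+1.-tuple int) (u : int -> Zmod m) :
    int -> Zmod m :=
  fun i => \sum_(j < r.*2.+1) u (i + widx j) *~ tnth W j.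

Definition AP (m : nat) (a d : Zmod m) : int -> Zmod m := fun i => a + d *~ i.

(* aca_orbit W u i j is the entry in column i of row j. *)
Definition aca_orbit (m r : nat) (W : r.*2.+1.-tuple int) (u : int -> Zmod m)
    (i : int) (j : nat) : Zmod m :=
  iter j (aca W) u i.

Definition triangle_in_range (j : int * nat) (e : int * int) (s : nat) : Prop :=
  forall k1 k2 : nat, (k1 + k2 <= s - 1)%N -> 0 <= j.2%:Z + e.2 * k2%:Z.

(* The value a_{j + e.k}. The absolute value only casts the row index to nat:
   it is the identity on the triangles satisfying triangle_in_range. *)
Definition entry (m : nat) (A : int -> nat -> Zmod m) (j : int * nat)
    (e : int * int) (k1 k2 : nat) : Zmod m :=
  A (j.1 + e.1 * k1%:Z) `|(j.2%:Z + e.2 * k2%:Z)%R|%N.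

(* The multiset, as a sequence up to order; k1, k2 <= s - 1 is automatic. *)
Definition triangle (m : nat) (A : int -> nat -> Zmod m) (j : int * nat)
    (e : int * int) (s : nat) : seq (Zmod m) :=
  [seq entry A j e k.1 k.2 |
    k : 'I_s * 'I_s in [pred k : 'I_s * 'I_s | (k.1 + k.2 <= s - 1)%N]].

Definition antisymmetric01 (m : nat) (A : int -> nat -> Zmod m) (j : int * nat)
    (e : int * int) (s : nat) : Prop :=
  forall k1 k2 : nat, (k1 + k2 <= s - 1)%N ->
    entry A j e k1 k2 + entry A j e (s - 1 - k1 - k2)%N k2 = 0.

Definition balanced (m : nat) (t : seq (Zmod m)) : Prop :=
  forall x y : Zmod m, count_mem x t = count_mem y t.

Definition pm1_power (m : nat) (x : int) (k : nat) : bool :=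
  (0 < k)%N && ((x ^+ k == 1 %[mod m])%Z || (x ^+ k == - 1 %[mod m])%Z).

Lemma pm1_power_exists (m : nat) (x : int) :
  invertible_mod m x -> exists k, pm1_power m x k.
Proof.
move=> [y xy1].
have cop : coprime `|x| m.
  rewrite /coprime -dvdn1; set g := gcdn _ _.
  have gm : (g%:Z %| m%:Z)%Z by rewrite dvdzE /= dvdn_gcdr.
  have gx : (g%:Z %| x)%Z by rewrite dvdzE /= dvdn_gcdl.
  have gxy : (g%:Z %| x * y)%Z by rewrite dvdz_mulr.
  have : (m%:Z %| x * y - 1)%Z by rewrite -eqz_mod_dvd; apply/eqP.
  move/(dvdz_trans gm) => gB.
  have : (g%:Z %| x * y - (x * y - 1))%Z by apply: rpredB.
  by rewrite opprB addrC subrK dvdzE.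
have [m0|m_gt0] := posnP m.
  exists 1%N; rewrite m0 /pm1_power /= expr1.
  move: cop; rewrite m0 /coprime gcdn0 => /eqP.
  by case: x {xy1} => n /= [->]; rewrite eqxx ?orbT.
exists (totient m * 2)%N; rewrite /pm1_power muln_gt0 totient_gt0 m_gt0 /=.
apply/orP; left; apply/eqP.
have -> : x ^+ (totient m * 2) = ((`|x| ^ totient m) ^ 2)%N.
  by rewrite exprM -abszX -[RHS]/(`|(x ^+ totient m)|%N%:Z ^+ 2) abszE
     real_normK ?num_real.
by rewrite modz_nat -modnXm Euler_exp_totient // modnXm exp1n modz_nat.
Qed.

Definition pord (m : nat) (x : int) (hx : invertible_mod m x) : nat :=
  ex_minn (pm1_power_exists hx).

(* Main.v *)
Require Import Defs.
From mathcomp Require Import all_boot all_algebra cyclic.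
From mathcomp Require Import zify ring.

(** Since sigma = 2 sigma', the orbit satisfies
    2 a_(i,j) = sigma^j (2a + (2i + j) d).  Antisymmetry of the first row of the
    triangle pins down the centre, and then the row of length n + 1 is, up to a
    fixed unit, rho^-n * {-n, -n + 2, ..., n} with rho = sigma or sigma^-1.  It
    remains to see that, when m | L and rho^L = +-1 mod m, the union of these
    rows for n < L is equidistributed modulo m.  The multiplicity N_n(y) of y in
    {-n, ..., n} satisfies N_n(y + 1) - N_n(y - 1) = [y = -(n+1)] - [y = n+1],
    which determines N_n up to a constant because m is odd.  Summing over the n
    congruent to t modulo P = phi(m) gives, up to a constant, a multiple of N_t
    taken modulo gcd(P, m) < m, and one concludes by induction on m. *)

Set Implicit Arguments.
Unset Strict Implicit.
Unset Printing Implicit Defensive.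

Import GRing.Theory.
Local Open Scope ring_scope.

Definition periodic (T : Type) (p : nat) (f : int -> T) : Prop :=
  forall y, f (y + p%:Z) = f y.

Lemma periodic1_const (T : Type) (f : int -> T) :
  periodic 1 f -> forall x, f x = f 0.
Proof.
move=> f1; elim/int_rect => // n IHn; first by rewrite intS addrC f1.
by rewrite -f1 -IHn; congr f; lia.
Qed.

Lemma odd_periodic_const (T : Type) (m : nat) (f : int -> T) :
    odd m -> periodic m f -> (forall y, f (y + 1) = f (y - 1)) ->
  forall x y, f x = f y.
Proof.
move=> m_odd fm f2.
have f_double k y : f (y + k.*2%:Z) = f y.
  elim: k => [|k IHk]; first by rewrite addr0.
  rewrite -IHk; have -> : y + k.+1.*2%:Z = (y + k.*2%:Z + 1) + 1 by lia.
  by rewrite f2 addrK.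
have f1 : periodic 1 f.
  move=> y; rewrite -[RHS]fm -(f_double m./2 (y + 1)); congr f.
  by have := odd_double_half m; rewrite m_odd; lia.
by move=> x y; rewrite !(periodic1_const f1).
Qed.

Lemma subr_eqAC (V : zmodType) (x y z t : V) :
  (x - y == z - t) = (x - z == y - t).
Proof. by rewrite !subr_eq addrAC [z + y]addrC addrAC. Qed.

Definition eq_upto_const (V : zmodType) (f g : int -> V) : Prop :=
  forall x y, f x - f y = g x - g y.

Lemma eq_upto_const_sum (V : zmodType) (I : finType)
    (f g : I -> int -> V) (h : I -> int -> int) :
    (forall i, eq_upto_const (f i) (g i)) ->
  eq_upto_const (fun x => \sum_i f i (h i x)) (fun x => \sum_i g i (h i x)).
Proof. by move=> fg x y; rewrite -!sumrB; apply: eq_bigr => i _; apply: fg. Qed.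

Lemma odd_periodic_eq_upto_const (V : zmodType) (m : nat) (f g : int -> V) :
    odd m -> periodic m f -> periodic m g ->
    (forall y, f (y + 1) - f (y - 1) = g (y + 1) - g (y - 1)) ->
  eq_upto_const f g.
Proof.
move=> m_odd fm gm fg x y; apply/eqP; rewrite subr_eqAC; apply/eqP.
apply: (@odd_periodic_const _ m (fun z => f z - g z)) => // z.
  by rewrite fm gm.
by apply/eqP; rewrite subr_eqAC fg.
Qed.

Lemma sum_periodic_shift (V : zmodType) (p : nat) (f : int -> V) (u : int) :
  periodic p f -> \sum_(q < p) f (q%:Z + u) = \sum_(q < p) f q%:Z.
Proof.
move=> fp; have shift1 : periodic 1 (fun u => \sum_(q < p) f (q%:Z + u)).
  move=> v; apply/eqP; rewrite -subr_eq0 -sumrB.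
  rewrite -(big_mkord xpredT (fun q => f (q%:Z + (v + 1)) - f (q%:Z + v))).
  have shiftS (q : nat) : q%:Z + (v + 1) = q.+1%:Z + v by lia.
  under eq_bigr => q _ do rewrite shiftS.
  rewrite (telescope_sumr (fun q => f (q%:Z + v))) //.
  by rewrite [p%:Z + v]addrC fp add0r subrr.
by rewrite (periodic1_const shift1); apply: eq_bigr => q _; rewrite addr0.
Qed.

Definition dvd_indicator (m : nat) (z : int) : int := (m %| z)%Z%:R.

Lemma dvd_indicatorN (m : nat) (z : int) :
  dvd_indicator m (- z) = dvd_indicator m z.
Proof. by rewrite /dvd_indicator rpredN. Qed.

Lemma dvd_indicatorDr (m : nat) (y z : int) :
  (m %| y)%Z -> dvd_indicator m (z + y) = dvd_indicator m z.
Proof. by move=> my; rewrite /dvd_indicator rpredDr. Qed.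

Lemma dvd_indicatorDl (m : nat) (y z : int) :
  (m %| y)%Z -> dvd_indicator m (y + z) = dvd_indicator m z.
Proof. by rewrite addrC; apply: dvd_indicatorDr. Qed.

Lemma periodic_dvd_indicatorM (m p : nat) (c : int) :
  (m %| p)%N -> periodic p (fun q => dvd_indicator m (c * q)).
Proof. by move=> mp q; rewrite mulrDr dvd_indicatorDr ?dvdz_mull. Qed.

Lemma sum_dvd_indicator_progression (m P L : nat) (z : int) : (m %| L)%N ->
  \sum_(q < L) dvd_indicator m (P%:Z * q%:Z + z) =
  (\sum_(q < L) dvd_indicator m (P%:Z * q%:Z)) * dvd_indicator (gcdn P m) z.
Proof.
move=> mL; rewrite [dvd_indicator (gcdn P m) z]/dvd_indicator.
have [/dvdzP[c ->]|gz] := boolP (_ %| z)%Z; last first.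
  rewrite mulr0 big1 // => q _; rewrite /dvd_indicator.
  have [mz|//] := boolP (_ %| _)%Z; case/negP: gz.
  have gP : ((gcdn P m)%:Z %| P%:Z * q%:Z)%Z by apply/dvdz_mulr/dvdn_gcdl.
  have gm : ((gcdn P m)%:Z %| m%:Z)%Z by apply: dvdn_gcdr.
  by rewrite -(rpredDl _ gP) (dvdz_trans gm).
have [u [v uv]] := Bezoutz P m.
have -> : (gcdn P m)%:Z = gcdz P m by [].
rewrite mulr1 -(sum_periodic_shift (c * u) (periodic_dvd_indicatorM P mL)).
apply: eq_bigr => q _; rewrite -[RHS](@dvd_indicatorDr _ (c * v * m)).
  by rewrite -uv; congr dvd_indicator; ring.
exact: dvdz_mull.
Qed.

Definition row_count (m n : nat) (y : int) : int :=
  \sum_(k < n.+1) dvd_indicator m (k%:Z *+ 2 - n%:Z - y).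

Lemma row_count_step (m n : nat) (y : int) :
  row_count m n (y + 1) - row_count m n (y - 1) =
  dvd_indicator m (n.+1%:Z + y) - dvd_indicator m (n.+1%:Z - y).
Proof.
pose f k := - dvd_indicator m (k%:Z *+ 2 - n.+1%:Z - y).
rewrite /row_count -sumrB (eq_bigr (fun k : 'I_n.+1 => f k.+1 - f k)) => [|k _].
  rewrite -(big_mkord xpredT (fun k => f k.+1 - f k)) telescope_sumr //.
  rewrite /f opprK addrC -[in LHS]dvd_indicatorN.
  by congr (dvd_indicator _ _ - dvd_indicator _ _); lia.
rewrite /f opprK addrC.
by congr (- dvd_indicator _ _ + dvd_indicator _ _); lia.
Qed.

Lemma row_count_congr (m n : nat) (x y : int) :
  (x = y %[mod m])%Z -> row_count m n x = row_count m n y.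
Proof.
move=> /eqP; rewrite eqz_mod_dvd => xy; apply: eq_bigr => k _.
by rewrite -(dvd_indicatorDr _ xy); congr dvd_indicator; ring.
Qed.

Lemma periodic_row_count (m p n : nat) :
  (m %| p)%N -> periodic p (row_count m n).
Proof.
move=> mp y; apply: row_count_congr; apply/eqP.
by rewrite eqz_mod_dvd addrAC subrr add0r.
Qed.

Lemma row_countN (m n : nat) (y : int) : row_count m n (- y) = row_count m n y.
Proof.
rewrite /row_count (reindex_inj rev_ord_inj) /=; apply: eq_bigr => k _.
rewrite -dvd_indicatorN; congr dvd_indicator.
by have := ltn_ord k; lia.
Qed.

Lemma row_countD_dvd (m n p : nat) : odd m -> (m %| p)%N ->
  eq_upto_const (row_count m (n + p)) (row_count m n).
Proof.
move=> m_odd mp; apply: (odd_periodic_eq_upto_const m_odd) => [||y];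
  [exact: periodic_row_count | exact: periodic_row_count | ].
rewrite !row_count_step -addSn PoszD -![n.+1%:Z + p%:Z + _]addrAC.
by rewrite !(dvd_indicatorDr _ (mp : (m %| p%:Z)%Z)).
Qed.

Lemma row_count_const (m n : nat) (x y : int) : odd m -> (m %| n.+1)%N ->
  row_count m n x = row_count m n y.
Proof.
move=> m_odd mn; apply: (odd_periodic_const m_odd) => z.
  exact: periodic_row_count.
apply/eqP; rewrite -subr_eq0 row_count_step.
by rewrite !(dvd_indicatorDl _ (mn : (m %| n.+1%:Z)%Z)) dvd_indicatorN subrr.
Qed.

Lemma sum_row_count_progression (m P L t : nat) : odd m -> (m %| L)%N ->
  eq_upto_const (fun y => \sum_(q < L) row_count m (P * q + t) y)
    (fun y => (\sum_(q < L) dvd_indicator m (P%:Z * q%:Z)) *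
              row_count (gcdn P m) t y).
Proof.
move=> m_odd mL; apply: (odd_periodic_eq_upto_const m_odd) => y.
- by apply: eq_bigr => q _; rewrite periodic_row_count.
- by rewrite periodic_row_count // dvdn_gcdr.
rewrite -mulrBr row_count_step mulrBr -!sum_dvd_indicator_progression //.
rewrite -!sumrB; apply: eq_bigr => q _; rewrite row_count_step.
by congr (dvd_indicator _ _ - dvd_indicator _ _); lia.
Qed.

Definition pm1_mod (m : nat) (z : int) : Prop :=
  exists n : nat, (z = (-1) ^+ n %[mod m])%Z.

Lemma pm1_modX (m : nat) (z : int) (k : nat) :
  pm1_mod m z -> pm1_mod m (z ^+ k).
Proof.
by move=> [n zn]; exists (n * k)%N; rewrite -modzXm zn modzXm exprM.
Qed.

Lemma pm1_mod_dvd (g m : nat) (z : int) :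
  (g %| m)%N -> pm1_mod m z -> pm1_mod g z.
Proof.
move=> gm [n /eqP]; rewrite eqz_mod_dvd => /(dvdz_trans (gm : (g %| m%:Z)%Z)).
by rewrite -eqz_mod_dvd => /eqP; exists n.
Qed.

Lemma pm1_mod_coprime (m L : nat) (x : int) :
  (0 < L)%N -> pm1_mod m (x ^+ L) -> coprime `|x| m.
Proof.
move=> L_gt0 [n xLn]; have : coprimez (x ^+ L) m.
  rewrite /coprimez -gcdz_modl xLn gcdz_modl -/(coprimez _ _) coprimezXl //.
  by rewrite coprimezE abszN coprime1n.
by rewrite coprimez_pexpl.
Qed.

Lemma pm1_mod_totient (m : nat) (x : int) :
  coprime `|x| m -> pm1_mod m (x ^+ totient m).
Proof.
move=> cop; exists ((x < 0)%R * totient m)%N.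
rewrite {1}[x]intEsign exprMn -exprM -modzMmr.
rewrite -natz -natrX natz modz_nat Euler_exp_totient //.
by rewrite -modz_nat modzMmr mulr1.
Qed.

Lemma row_count_pm1_mul (m n : nat) (z x : int) :
  pm1_mod m z -> row_count m n (z * x) = row_count m n x.
Proof.
move=> [k zk].
have -> : row_count m n (z * x) = row_count m n ((-1) ^+ k * x).
  by apply: row_count_congr; rewrite -modzMml zk modzMml.
by rewrite -signr_odd mulr_sign; case: odd; rewrite ?row_countN.
Qed.

(* For rho invertible modulo m, the multiplicity of x in the triangle with rows
   rho^-n * {-n, -n + 2, ..., n} for n < L. *)
Definition triangle_count (m : nat) (rho : int) (L : nat) (x : int) : int :=
  \sum_(n < L) row_count m n (rho ^+ n * x).

Lemma triangle_count_residues (m P k : nat) (rho x : int) :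
    pm1_mod m (rho ^+ P) ->
  triangle_count m rho (k * P) x =
  \sum_(t < P) \sum_(q < k) row_count m (P * q + t) (rho ^+ t * x).
Proof.
move=> rhoP; rewrite exchange_big /triangle_count.
rewrite -(big_mkord xpredT (fun n => row_count m n (rho ^+ n * x))) big_nat_mul.
rewrite big_mkord; apply: eq_bigr => q _ /=.
rewrite -[(q * P)%N]add0n big_addn mulSn addnK big_mkord; apply: eq_bigr => t _.
rewrite addnC mulnC exprD exprM -mulrA.
by rewrite (row_count_pm1_mul _ _ (pm1_modX q rhoP)).
Qed.

Lemma triangle_count_mul (m L k : nat) (rho : int) :
    odd m -> (m %| L)%N -> pm1_mod m (rho ^+ L) ->
  eq_upto_const (triangle_count m rho (k * L))
                (fun x => k%:Z * triangle_count m rho L x).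
Proof.
move=> m_odd mL rhoL x y.
rewrite !(triangle_count_residues _ _ rhoL).
rewrite exchange_big [X in _ - X]exchange_big -sumrB.
rewrite (eq_bigr (fun=> triangle_count m rho L x - triangle_count m rho L y)).
  by rewrite sumr_const card_ord -mulr_natl natz mulrBr.
move=> q _; have row_shift (t : 'I_L) :
    eq_upto_const (row_count m (L * q + t)) (row_count m t).
  by rewrite addnC; apply: row_countD_dvd m_odd (dvdn_mulr _ mL).
exact: (eq_upto_const_sum (fun (t : 'I_L) x => rho ^+ t * x) row_shift x y).
Qed.

Lemma triangle_count_gcd (m P L : nat) (rho : int) :
    odd m -> (m %| L)%N -> pm1_mod m (rho ^+ P) ->
  eq_upto_const (triangle_count m rho (L * P))
    (fun x => (\sum_(q < L) dvd_indicator m (P%:Z * q%:Z)) *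
              triangle_count (gcdn P m) rho P x).
Proof.
move=> m_odd mL rhoP x y.
rewrite !(triangle_count_residues _ _ rhoP) !mulr_sumr.
exact: (eq_upto_const_sum (fun (t : 'I_P) x => rho ^+ t * x)
  (fun t => sum_row_count_progression P t m_odd mL) x y).
Qed.

Lemma totient_lt (m : nat) : (1 < m)%N -> (totient m < m)%N.
Proof.
move=> m_gt1; rewrite totient_count_coprime big_ltn ?(ltnW m_gt1) //.
have -> : coprime m 0 = false by rewrite /coprime gcdn0; apply/eqP; lia.
have : (\sum_(1 <= d < m) coprime m d <= \sum_(1 <= d < m) 1)%N.
  by apply: leq_sum => d _; exact: leq_b1.
by rewrite sum_nat_const_nat; lia.
Qed.

Lemma triangle_count_const (m L : nat) (rho x y : int) :
    odd m -> (m %| L)%N -> pm1_mod m (rho ^+ L) ->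
  triangle_count m rho L x = triangle_count m rho L y.
Proof.
elim/ltn_ind: m L x y => m IHm L x y m_odd mL rhoL.
have [->|L_gt0] := posnP L; first by rewrite /triangle_count !big_ord0.
have [m1|m_neq1] := eqVneq m 1%N.
  by apply: eq_bigr => n _; apply: row_count_congr; rewrite m1 !modz1.
have m_gt1 : (1 < m)%N by case: m m_odd m_neq1 {IHm mL rhoL} => [|[]].
pose P := totient m; have P_gt0 : (0 < P)%N by rewrite totient_gt0 ltnW.
have rhoP : pm1_mod m (rho ^+ P).
  exact/pm1_mod_totient/(pm1_mod_coprime L_gt0).
have gm : (gcdn P m %| m)%N by apply: dvdn_gcdr.
have /eqP : P%:Z * triangle_count m rho L x = P%:Z * triangle_count m rho L y.
  apply/eqP; rewrite -subr_eq0 -(triangle_count_mul P m_odd mL rhoL).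
  rewrite mulnC (triangle_count_gcd m_odd mL rhoP) -mulrBr mulf_eq0 subr_eq0.
  apply/orP; right; apply/eqP/IHm.
  - exact: leq_ltn_trans (dvdn_leq P_gt0 (dvdn_gcdl P m)) (totient_lt m_gt1).
  - exact: dvdn_odd gm m_odd.
  - exact: dvdn_gcdl.
  - exact: pm1_mod_dvd gm rhoP.
by rewrite -subr_eq0 -mulrBr mulf_eq0 subr_eq0 => /orP[|/eqP //]; lia.
Qed.

Lemma triangle_count_const_pred (m s : nat) (rho x y : int) :
    odd m -> (m %| s.+1)%N -> pm1_mod m (rho ^+ s.+1) ->
  triangle_count m rho s x = triangle_count m rho s y.
Proof.
move=> m_odd ms rhoS; have := triangle_count_const x y m_odd ms rhoS.
rewrite /triangle_count !big_ord_recr /=.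
by rewrite (row_count_const (rho ^+ s * x) (rho ^+ s * y) m_odd ms) => /addIr.
Qed.

(* Row n, at k2 = s - 1 - n, is the one with n + 1 entries. *)
Lemma count_triangle_rows (m : nat) (A : int -> nat -> Zmod m) (j : int * nat)
    (e : int * int) (s : nat) (x : Zmod m) :
  count_mem x (triangle A j e s) =
  (\sum_(n < s) \sum_(k < n.+1) (entry A j e k (s - 1 - n) == x))%N.
Proof.
rewrite /triangle -sum1_count big_image_cond big_mkcondr /=.
rewrite -(pair_big_dep xpredT (fun k1 k2 : 'I_s => (k1 + k2 <= s - 1)%N)
  (fun k1 k2 : 'I_s => if entry A j e k1 k2 == x then 1%N else 0%N)) /=.
rewrite (exchange_big_dep xpredT) //= (reindex_inj rev_ord_inj) /=.
apply: eq_bigr => n _; have n_lt := ltn_ord n.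
rewrite (big_ord_widen s
  (fun k => nat_of_bool (entry A j e k (s - 1 - n) == x))) //.
apply: eq_big => [k|k _]; first by lia.
by rewrite (_ : (s - n.+1)%N = (s - 1 - n)%N); [case: eqP | lia].
Qed.

Lemma balanced_dilated_rows (m s L : nat) (A : int -> nat -> Zmod m)
    (j : int * nat) (e : int * int) (rho : int) (y : Zmod m -> int) :
    odd m -> (m %| L)%N -> pm1_mod m (rho ^+ L) -> L = s \/ L = s.+1 ->
    (forall n k x, (n < s)%N -> (k <= n)%N ->
      (entry A j e k (s - 1 - n) == x) =
      (k%:Z *+ 2 - n%:Z == rho ^+ n * y x %[mod m])%Z) ->
  balanced (triangle A j e s).
Proof.
move=> m_odd mL rhoL Ls entryE.
have countE x :
    (count_mem x (triangle A j e s))%:Z = triangle_count m rho s (y x).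
  rewrite count_triangle_rows -natz natr_sum; apply: eq_bigr => n _.
  rewrite natr_sum; apply: eq_bigr => k _.
  by rewrite entryE ?eqz_mod_dvd // -ltnS.
move=> x x'; apply/eqP; rewrite -eqz_nat !countE; apply/eqP.
case: Ls mL rhoL => ->; first exact: triangle_count_const.
exact: triangle_count_const_pred.
Qed.

Lemma eq_aca (m r : nat) (W : r.*2.+1.-tuple int) (u v : int -> Zmod m) :
  u =1 v -> aca W u =1 aca W v.
Proof. by move=> uv i; apply: eq_bigr => k _; rewrite uv. Qed.

Lemma aca_AP (m r : nat) (W : r.*2.+1.-tuple int) (a d : Zmod m) :
  aca W (AP a d) =1 AP (a *~ sigma W + d *~ sigma' W) (d *~ sigma W).
Proof.
move=> i; rewrite /aca /AP -mulrzA mulr_suml !mulrz_sumr -!big_split /=.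
apply: eq_bigr => k _; rewrite mulrzDl -!mulrzA -addrA -mulrzDr.
by congr (_ + d *~ _); ring.
Qed.

Lemma aca_orbit_AP (m r : nat) (W : r.*2.+1.-tuple int) (a d : Zmod m)
    (j : nat) :
  (aca_orbit W (AP a d))^~ j =1
  AP (a *~ sigma W ^+ j + d *~ (sigma' W * sigma W ^+ j.-1 *+ j))
     (d *~ sigma W ^+ j).
Proof.
elim: j => [|j IHj] i; first by rewrite expr0 mulr0n mulr0z addr0.
rewrite /aca_orbit iterS (eq_aca W IHj) aca_AP /AP mulrzDl -!mulrzA -exprSr.
rewrite -[_ + _ + d *~ (_ * sigma' W)]addrA -mulrzDr.
congr (_ + d *~ _ + d *~ _); last by rewrite exprS mulrA [_ * sigma W]mulrC.
by case: j {IHj} => [|j] /=; rewrite ?exprS; ring.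
Qed.

Lemma aca_orbit_AP_double (m r : nat) (W : r.*2.+1.-tuple int) (a d : Zmod m)
    (i : int) (j : nat) : sigma W = 2 * sigma' W ->
  aca_orbit W (AP a d) i j *+ 2 =
  (a *+ 2 + d *~ (i *+ 2 + j%:Z)) *~ sigma W ^+ j.
Proof.
move=> sigmaE; rewrite aca_orbit_AP /AP !mulrnDl mulrzDl.
rewrite -[a *+ 2]/(a *~ 2) -![_ *~ _ *+ 2]/(_ *~ _ *~ 2).
rewrite -!mulrzA -addrA -mulrzDr.
congr (a *~ _ + d *~ _); first by ring.
case: j => [|j] /=; first by ring.
by rewrite exprS; move: (sigma W ^+ j) => x; rewrite sigmaE; ring.
Qed.

Lemma Zp_intr_eq (p : nat) (a b : int) :
  (a%:~R == b%:~R :> 'I_p.+2) = (a == b %[mod p.+2])%Z.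
Proof.
have nat_eq0 n : (n%:R == 0 :> 'I_p.+2) = (p.+2 %| n)%N.
  by rewrite Zp_nat -val_eqE.
rewrite eqz_mod_dvd -subr_eq0 -intrB; case: (a - b) => n; first exact: nat_eq0.
by rewrite NegzE rpredN mulrNz oppr_eq0 nat_eq0.
Qed.

Lemma Zp_intr_val (p : nat) (x : 'I_p.+2) : (val x)%:Z%:~R = x.
Proof. exact: natr_Zp. Qed.

Lemma Zp_pm1_mod (p : nat) (z : int) :
  pm1_mod p.+2 z <-> exists n : nat, z%:~R = (-1) ^+ n :> 'I_p.+2.
Proof.
have signE n : (-1) ^+ n = ((-1) ^+ n)%:~R :> 'I_p.+2.
  by rewrite rmorphXn /= mulrN1z.
by split=> -[n /eqP zn]; exists n; apply/eqP; rewrite signE Zp_intr_eq in zn *.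
Qed.

Lemma pm1_mod_Zp_exprz (p L : nat) (x z : int) : pm1_mod p.+2 (x ^+ L) ->
  pm1_mod p.+2 ((val (x%:~R ^ z : 'I_p.+2))%:Z ^+ L).
Proof.
move=> /Zp_pm1_mod[n xLn]; apply/Zp_pm1_mod; exists (n * `|z|)%N.
rewrite rmorphXn /= Zp_intr_val exprnP exprzAC -exprnP -rmorphXn /= xLn.
by case: z => k; rewrite exprM //= NegzE -exprnN -exprVn invr_sign.
Qed.

Lemma invertible_mod_unit (p : nat) (x : int) :
  invertible_mod p.+2 x -> (x%:~R : 'I_p.+2) \is a GRing.unit.
Proof.
move=> [y xy]; apply/unitrPr; exists y%:~R.
by apply/eqP; rewrite -intrM -[1]/(1%:~R) Zp_intr_eq xy.
Qed.

Lemma invertible_unit (p : nat) (d : 'I_p.+2) :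
  @invertible p.+2 d -> d \is a GRing.unit.
Proof. by move=> [e de]; apply/unitrPr; exists e. Qed.

Lemma odd_unit2 (p : nat) : odd p.+2 -> (2%:R : 'I_p.+2) \is a GRing.unit.
Proof. by move=> p_odd; rewrite (@unitZpE p.+2) // coprimen2. Qed.

Section AntisymmetricTriangle.

Variables (p r : nat) (W : r.*2.+1.-tuple int) (a d : 'I_p.+2).
Variables (j : int * nat) (eps : int) (s : nat).

Hypotheses (p_odd : odd p.+2) (sigmaE : sigma W = 2 * sigma' W).
Local Notation sigma_p := ((sigma W)%:~R : 'I_p.+2).
Hypothesis unit_sigma : sigma_p \is a GRing.unit.
Hypothesis unit_d : d \is a GRing.unit.
Hypothesis unit_eps : eps \is a GRing.unit.

Local Notation A := (@aca_orbit p.+2 r W (@AP p.+2 a d)).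
Hypothesis in_range : triangle_in_range j (eps, eps) s.
Hypothesis antisym : antisymmetric01 A j (eps, eps) s.

Lemma orbit_double (i : int) (k : nat) :
  A i k *+ 2 = (a *+ 2 + d * (i *+ 2 + k%:Z)%:~R) * sigma_p ^+ k.
Proof. by rewrite aca_orbit_AP_double // -rmorphXn /= !mulrzr. Qed.

Lemma antisym_center :
  a *+ 2 + d * (j.1 *+ 2 + j.2%:Z + eps * (s - 1)%N%:Z)%:~R = 0.
Proof.
have unitw : 2%:R * sigma_p ^+ j.2 \is a GRing.unit.
  by rewrite unitrM odd_unit2 ?unitrX.
apply: (mulIr unitw); rewrite mul0r.
have := @antisym 0%N 0%N isT.
rewrite /entry /= !mulr0 !addr0 !subn0 => cornersE.
rewrite -[RHS](mul0rn _ 2) -cornersE mulrnDl !orbit_double.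
by rewrite !intrD !intrM; ring.
Qed.

Local Notation scale :=
  (eps%:~R * d * sigma_p ^ (j.2%:Z + eps * (s - 1)%N%:Z)).

(* Increasing n by 1 shifts the time index by - eps, hence the dilation by
   sigma ^ (- eps). *)
Lemma antisym_entry_double (n k : nat) : (n < s)%N -> (k <= n)%N ->
  entry A j (eps, eps) k (s - 1 - n) *+ 2 =
  scale * (k%:Z *+ 2 - n%:Z)%:~R / (sigma_p ^ eps) ^+ n.
Proof.
move=> n_lt k_le; rewrite /entry /= orbit_double.
rewrite [_ ^+ absz _]exprnP gez0_abs; last first.
  by apply: (@in_range 0%N); rewrite add0n leq_subr.
have -> : j.2%:Z + eps * (s - 1 - n)%N%:Z =
    (j.2%:Z + eps * (s - 1)%N%:Z) + eps * (- n%:Z).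
  by rewrite -subzn; [ring | lia].
rewrite (exprzDr unit_sigma) -exprz_exp -exprnN mulrA; congr (_ / _).
rewrite mulrAC; congr (_ * _).
rewrite -[LHS]subr0 -antisym_center opprD addrACA subrr add0r -mulrBr -intrB.
by rewrite [_ * d]mulrC -mulrA -intrM; congr (d * _%:~R); ring.
Qed.

Lemma antisym_entry_eq (n k : nat) (x : 'I_p.+2) : (n < s)%N -> (k <= n)%N ->
  (entry A j (eps, eps) k (s - 1 - n) == x) =
  (k%:Z *+ 2 - n%:Z ==
     (val (sigma_p ^ eps))%:Z ^+ n * (val (x *+ 2 / scale))%:Z %[mod p.+2])%Z.
Proof.
move=> n_lt k_le; rewrite -Zp_intr_eq intrM Zp_intr_val rmorphXn /= Zp_intr_val.
rewrite -[LHS](inj_eq (mulIr (odd_unit2 p_odd))) !mulr_natr.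
rewrite antisym_entry_double //.
set q := _ ^+ n.
have unitq : q \is a GRing.unit by rewrite unitrX // unitrXz.
have unit_scale : scale \is a GRing.unit.
  by rewrite !unitrM unit_d rmorph_unit // unitrXz.
rewrite -(can_eq (mulrK unitq)) divrK //.
rewrite -[RHS](inj_eq (mulrI unit_scale)) mulrCA [scale * (_ / _)]mulrC.
by rewrite divrK // [q * _]mulrC.
Qed.

End AntisymmetricTriangle.

Lemma mod_0_or_N1_dvdn (s M : nat) :
  (s%:Z = 0 %[mod M%:Z])%Z \/ (s%:Z = -1 %[mod M%:Z])%Z ->
  exists2 L, (M %| L)%N & L = s \/ L = s.+1.
Proof.
case=> /eqP; rewrite eqz_mod_dvd.
- by rewrite subr0; exists s => //; left.
- by rewrite opprK -PoszD addn1; exists s.+1 => //; right.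
Qed.

Lemma pm1_modX_pord (m : nat) (x : int) (hx : invertible_mod m x) (L : nat) :
  (pord hx %| L)%N -> pm1_mod m (x ^+ L).
Proof.
rewrite /pord; case: ex_minnP => k /andP[_ xk] _ /dvdnP[q ->].
rewrite mulnC exprM; apply: pm1_modX.
by case/orP: xk => /eqP; [exists 0%N | exists 1%N].
Qed.

Theorem theorem5p5 (m : nat) (hm : odd m)
  (r : nat) (W : r.*2.+1.-tuple int)
  (hW : sigma W = 2 * sigma' W)
  (hsigma : invertible_mod m (sigma W))
  (a d : Zmod m) (hd : invertible d)
  (s : nat) (hs : (0 < s)%N)
  (hsmod : (s%:Z = 0 %[mod (lcmn (pord hsigma) m)%:Z])%Z \/
           (s%:Z = -1 %[mod (lcmn (pord hsigma) m)%:Z])%Z)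
  (j : int * nat) (e : int * int)
  (he : e = (1, 1) \/ e = (-1, -1))
  (hrange : triangle_in_range j e s)
  (hanti : antisymmetric01 (aca_orbit W (AP a d)) j e s) :
  balanced (triangle (aca_orbit W (AP a d)) j e s).
Proof.
have [L lcmL Ls] := mod_0_or_N1_dvdn hsmod.
have mL : (m %| L)%N := dvdn_trans (dvdn_lcmr _ _) lcmL.
have sigmaL : pm1_mod m (sigma W ^+ L).
  exact: pm1_modX_pord (dvdn_trans (dvdn_lcml _ _) lcmL).
have [eps unit_eps eE] :
    exists2 eps : int, eps \is a GRing.unit & e = (eps, eps).
  by case: he => ->; [exists 1 | exists (-1)].
rewrite {e he}eE in hrange hanti *.
case: m hm hsigma a d hd mL sigmaL hanti {hsmod lcmL} =>
  [//|[|p]] hm hsigma a d hd mL sigmaL hanti.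
  by move=> x y; congr (count_mem _ _); rewrite [x]ord1 [y]ord1.
apply: (balanced_dilated_rows hm mL (pm1_mod_Zp_exprz eps sigmaL) Ls).
move=> n k x n_lt k_le; apply: antisym_entry_eq => //.
- exact: invertible_mod_unit.
- exact: invertible_unit.
Qed.
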